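(* Let $R$ be a complete local-filtered ring, and let $M$ be an $R$-space. If $(G^i(M))_{i\ge0}$ and $(H^i(M))_{i\ge0}$ are two permissible filtrations on $M$, then the $\mathrm{gr}(R)$-modules $$\frac{G^0(M)}{G^1(M)}\oplus\frac{G^1(M)}{G^2(M)}\oplus\cdots\quad\text{and}\quad\frac{H^0(M)}{H^1(M)}\oplus\frac{H^1(M)}{H^2(M)}\oplus\cdots$$ have the same Krull dimension.
   Context: Rings are unital and not necessarily associative; ''commutative ring/algebra'' means commutative and associative. An $R$-space is an abelian group $M$ with a bilinear pairing $R\times M\to M$, $(r,m)\mapsto rm$, such that $1m=m$ for all $m\in M$ (no associativity is required). For subsets $A\subseteq R$ and $\Delta\subseteq M$, $A\Delta$ denotes the additive subgroup of all finite sums $\sum ax$ with $a\in A$, $x\in\Delta$ (and similarly for products of subsets of $R$). A filtered ring is a ring $R$ with a decreasing sequence of (two-sided) ideals $F^0(R)\supseteq F^1(R)\supseteq\cdots$ with $F^0(R)=R$ and $F^i(R)F^j(R)\subseteq F^{i+j}(R)$ for all $i,j\ge0$. A filtration on an $R$-space $M$ is a decreasing sequence of $R$-subspaces $F^0(M)\supseteq F^1(M)\supseteq\cdots$ with $F^0(M)=M$ and $F^i(R)F^j(M)\subseteq F^{i+j}(M)$ for all $i,j\ge0$; it is separated if $\bigcap_iF^i(M)=0$. $\mathrm{gr}(R)=\bigoplus_{i\ge0}F^i(R)/F^{i+1}(R)$ is a graded ring and $\mathrm{gr}(M)=\bigoplus_{i\ge0}F^i(M)/F^{i+1}(M)$ is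 a graded $\mathrm{gr}(R)$-space. A complete local-filtered ring is a filtered ring $R$ whose filtration is complete (i.e. $R\to\varprojlim R/F^i(R)$ is an isomorphism) and such that $R/F^1(R)$ is a field and $\mathrm{gr}(R)$ is a finitely generated commutative $R/F^1(R)$-algebra, generated in degree $1$. A filtration on an $R$-space $M$ is permissible if it is separated and the associated graded space $\mathrm{gr}(M)$ is a finitely generated $\mathrm{gr}(R)$-module (i.e. the $\mathrm{gr}(R)$-action is associative, so a usual module, and finitely generated). *)

(* Defs.v *)
From HB Require Import structures.
From mathcomp Require Import all_boot all_order all_algebra.
From mathcomp Require Import boolp classical_sets constructive_ereal.

Set Implicit Arguments.
Unset Strict Implicit.
Unset Printing Implicit Defensive.

Import Order.TTheory GRing.Theory Num.Theory.

Local Open Scope ring_scope.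

Local Open Scope quotient_scope.
Local Open Scope classical_set_scope.

(* Unital rings, not necessarily associative. *)
HB.mixin Record Zmodule_isNaRing R of GRing.Zmodule R := {
  na_one : R;
  na_mul : R -> R -> R;
  na_mulDl : forall a b c, na_mul (a + b) c = na_mul a c + na_mul b c;
  na_mulDr : forall a b c, na_mul a (b + c) = na_mul a b + na_mul a c;
  na_mul1l : forall a, na_mul na_one a = a;
  na_mul1r : forall a, na_mul a na_one = a
}.

#[short(type="naRingType")]
HB.structure Definition NaRing := {R of Zmodule_isNaRing R & GRing.Zmodule R}.

HB.mixin Record Zmodule_isSpace (R : naRingType) M of GRing.Zmodule M := {
  na_act : R -> M -> M;
  na_actDl : forall a b x, na_act (a + b) x = na_act a x + na_act b x;
  na_actDr : forall a x y, na_act a (x + y) = na_act a x + na_act a y;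
  na_act1 : forall x, na_act na_one x = x
}.

#[short(type="spaceType")]
HB.structure Definition Space (R : naRingType) :=
  {M of Zmodule_isSpace R M & GRing.Zmodule M}.

Notation "a ** b" := (na_mul a b) (at level 40, left associativity).
Notation "a **: x" := (na_act a x) (at level 40).

(* Associativity is included, as usual for "commutative ring". *)
Definition na_commutative (R : naRingType) :=
  commutative (@na_mul R) /\ associative (@na_mul R).

Definition na_field (K : naRingType) :=
  [/\ na_commutative K, (na_one : K) <> 0
    & forall a : K, a <> 0 -> exists b : K, a ** b = na_one].

(* Since each F (i + j) is an additive subgroup, F^i F^j `<=` F^(i+j) amounts
   to the condition on single products. *)
Record ringFiltration (R : naRingType) := RingFiltration {
  rfil :> nat -> zmodClosed R;
  rfil_ideal : forall i a b, b \in rfil i ->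
    a ** b \in rfil i /\ b ** a \in rfil i;
  rfil_decr : forall i a, a \in rfil i.+1 -> a \in rfil i;
  rfil0 : forall a, a \in rfil 0;
  rfil_mul : forall i j a b,
    a \in rfil i -> b \in rfil j -> a ** b \in rfil (i + j)
}.

Record spaceFiltration (R : naRingType) (F : ringFiltration R)
    (M : spaceType R) := SpaceFiltration {
  sfil :> nat -> zmodClosed M;
  sfil_subspace : forall i (a : R) x, x \in sfil i -> a **: x \in sfil i;
  sfil_decr : forall i x, x \in sfil i.+1 -> x \in sfil i;
  sfil0 : forall x, x \in sfil 0;
  sfil_act : forall i j (a : R) x,
    a \in F i -> x \in sfil j -> a **: x \in sfil (i + j)
}.

Definition quot_ring (R : naRingType) (F : ringFiltration R) (i : nat) : Type :=
  {ideal_quot F i}.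

Section QuotRing.
Variables (R : naRingType) (F : ringFiltration R) (i : nat).
Local Notation Q := (quot_ring F i).
Local Notation cls := (\pi_{ideal_quot F i}).

HB.instance Definition _ := GRing.Zmodule.on Q.

Definition quot_one : Q := cls na_one.
Definition quot_mul (x y : Q) : Q :=
  cls (repr (x : {ideal_quot F i}) ** repr (y : {ideal_quot F i})).

Lemma quot_eqP (a b : R) : (cls a = cls b) <-> (a - b \in F i).
Proof. by rewrite Quotient.idealrBE; split=> /eqP. Qed.

Lemma quot_mulE a b : quot_mul (cls a) (cls b) = cls (a ** b).
Proof.
have mul0l c : 0 ** c = 0 :> R.
  by apply: (addrI (0 ** c)); rewrite -na_mulDl !addr0.
have mul0r c : c ** 0 = 0 :> R.
  by apply: (addrI (c ** 0)); rewrite -na_mulDr !addr0.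
have mulNl c d : (- c) ** d = - (c ** d) :> R.
  by apply: (addrI (c ** d)); rewrite -na_mulDl !subrr mul0l.
have mulNr c d : c ** (- d) = - (c ** d) :> R.
  by apply: (addrI (c ** d)); rewrite -na_mulDr !subrr mul0r.
apply/quot_eqP; set a' := repr _; set b' := repr _.
have ha : a' - a \in F i by apply/quot_eqP; rewrite reprK.
have hb : b' - b \in F i by apply/quot_eqP; rewrite reprK.
have -> : a' ** b' - a ** b = a' ** (b' - b) + (a' - a) ** b.
  by rewrite na_mulDl na_mulDr mulNr mulNl addrA subrK.
by rewrite rpredD //; case: (rfil_ideal a' hb); case: (rfil_ideal b ha).
Qed.

Lemma quot_mulDl a b c : quot_mul (a + b) c = quot_mul a c + quot_mul b c.
Proof.
elim/quotW: a => a; elim/quotW: b => b; elim/quotW: c => c.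
by rewrite -raddfD !quot_mulE na_mulDl raddfD.
Qed.

Lemma quot_mulDr a b c : quot_mul a (b + c) = quot_mul a b + quot_mul a c.
Proof.
elim/quotW: a => a; elim/quotW: b => b; elim/quotW: c => c.
by rewrite -raddfD !quot_mulE na_mulDr raddfD.
Qed.

Lemma quot_mul1l a : quot_mul quot_one a = a.
Proof. by elim/quotW: a => a; rewrite quot_mulE na_mul1l. Qed.

Lemma quot_mul1r a : quot_mul a quot_one = a.
Proof. by elim/quotW: a => a; rewrite quot_mulE na_mul1r. Qed.

HB.instance Definition _ := Zmodule_isNaRing.Build Q
  quot_mulDl quot_mulDr quot_mul1l quot_mul1r.

End QuotRing.

(* R -> lim R / F^i(R) is bijective; the inverse limit consists of the
   families y with y_(i+1) |-> y_i under R / F^(i+1)(R) -> R / F^i(R). *)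
Definition complete (R : naRingType) (F : ringFiltration R) :=
  forall y : forall i, {ideal_quot F i},
    (forall i, \pi_{ideal_quot F i} (repr (y i.+1)) = y i) ->
    exists! x : R, forall i, \pi_{ideal_quot F i} x = y i.

(* For A and B additive subgroups of V, subquot A B is A / (A `&` B). *)
Section Subquotient.
Variables (V : zmodType) (A B : zmodClosed V).

Record subg := Subg { subg_val : V; subg_valP : subg_val \in A }.
HB.instance Definition _ := [isSub for subg_val].
HB.instance Definition _ := [Choice of subg by <:].
HB.instance Definition _ := [SubChoice_isSubZmodule of subg by <:].

Definition subg_restr : {pred subg} := fun x => val x \in B.

Lemma subg_restr_closed : zmod_closed subg_restr.
Proof.
split=> [|x y].
  by rewrite unfold_in raddf0 rpred0.
rewrite !unfold_in raddfB.
exact: rpredB.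
Qed.
HB.instance Definition _ :=
  GRing.isZmodClosed.Build subg subg_restr subg_restr_closed.

Definition subquot : Type := {ideal_quot subg_restr}.
HB.instance Definition _ := GRing.Zmodule.on subquot.

(* The class of v when v is in A, and 0 otherwise. *)
Definition sqcls (v : V) : subquot := \pi_{ideal_quot subg_restr} (insubd 0 v).
Definition sqrep (q : subquot) : V := val (repr (q : {ideal_quot subg_restr})).

Lemma sqrepP q : sqrep q \in A. Proof. exact: valP. Qed.

Lemma sqrepK q : sqcls (sqrep q) = q.
Proof. by rewrite /sqcls /sqrep valKd reprK. Qed.

Lemma sqclsD u v : u \in A -> v \in A -> sqcls (u + v) = sqcls u + sqcls v.
Proof.
move=> uA vA; rewrite /sqcls -raddfD; congr (\pi _); apply: val_inj.
by rewrite [RHS]raddfD /= !insubdK ?rpredD.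
Qed.

Lemma sqcls0 v : v \in B -> sqcls v = 0.
Proof.
move=> vB; rewrite /sqcls -[RHS](raddf0 (\pi_{ideal_quot subg_restr})).
apply/eqP; rewrite -Quotient.idealrBE subr0 unfold_in.
rewrite val_insubd; case: ifP => // _.
by rewrite raddf0 rpred0.
Qed.

Lemma sqclsP u v : u \in A -> v \in A -> sqcls u = sqcls v -> u - v \in B.
Proof.
move=> uA vA /eqP; rewrite -Quotient.idealrBE unfold_in.
by rewrite raddfB /= !insubdK.
Qed.

End Subquotient.

(* gr(V) = F^0 / F^1 (+) F^1 / F^2 (+) ... *)
Section Graded.
Variables (V : zmodType) (F : nat -> zmodClosed V).

Definition gr_piece (i : nat) : zmodType := subquot (F i) (F i.+1).

Record gr := Gr {
  gr_comp :> forall i, gr_piece i;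
  gr_finite : exists n, forall i, (n <= i)%N -> gr_comp i = 0
}.

Lemma grP (x y : gr) : (forall i, x i = y i) -> x = y.
Proof.
case: x => x hx; case: y => y hy /= xy.
have exy : x = y by apply: functional_extensionality_dep.
by case: y / exy hy {xy} => hy; congr Gr; apply: Prop_irrelevance.
Qed.

HB.instance Definition _ := gen_eqMixin gr.
HB.instance Definition _ := gen_choiceMixin gr.

Lemma gr_zero_fin : exists n, forall i, (n <= i)%N -> (0 : gr_piece i) = 0.
Proof. by exists 0%N. Qed.
Definition gr_zero := Gr gr_zero_fin.

Lemma gr_opp_fin (x : gr) : exists n, forall i, (n <= i)%N -> - x i = 0.
Proof. by case: (gr_finite x) => n xn; exists n => i /xn ->; rewrite oppr0. Qed.
Definition gr_opp x := Gr (gr_opp_fin x).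

Lemma gr_add_fin (x y : gr) : exists n, forall i, (n <= i)%N -> x i + y i = 0.
Proof.
case: (gr_finite x) (gr_finite y) => [m xm] [n yn]; exists (maxn m n) => i.
by rewrite geq_max => /andP[/xm -> /yn ->]; rewrite addr0.
Qed.
Definition gr_add x y := Gr (gr_add_fin x y).

Lemma gr_addA : associative gr_add.
Proof. by move=> x y z; apply: grP => i; apply: addrA. Qed.
Lemma gr_addC : commutative gr_add.
Proof. by move=> x y; apply: grP => i; apply: addrC. Qed.
Lemma gr_add0 : left_id gr_zero gr_add.
Proof. by move=> x; apply: grP => i; apply: add0r. Qed.
Lemma gr_addN : left_inverse gr_zero gr_opp gr_add.
Proof. by move=> x; apply: grP => i; apply: addNr. Qed.

HB.instance Definition _ :=
  GRing.isZmodule.Build gr gr_addA gr_addC gr_add0 gr_addN.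

Definition gr_cls (i : nat) (v : V) : gr_piece i := sqcls (F i) (F i.+1) v.
Definition gr_rep (i : nat) (q : gr_piece i) : V := sqrep q.

(* For v in F^i, the class of v in F^i / F^(i+1), placed in degree i. *)
Definition gr_hom_comp (i : nat) (v : V) (j : nat) : gr_piece j :=
  if j == i then gr_cls j v else 0.

Lemma gr_hom_fin i v : exists n, forall j, (n <= j)%N -> gr_hom_comp i v j = 0.
Proof.
by exists i.+1 => j; rewrite /gr_hom_comp; case: eqP => // ->; rewrite ltnn.
Qed.
Definition gr_hom i v := Gr (gr_hom_fin i v).

Definition gr_deg (i : nat) : set gr :=
  [set x | forall j, j != i -> x j = 0].

End Graded.

(* The product on graded objects induced by a filtered biadditive map; in
   degree n it is the sum over i of the products of the degrees i and n - i. *)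
Section GradedOp.
Variables (U V : zmodType) (F : nat -> zmodClosed U) (G : nat -> zmodClosed V).
Variable op : U -> V -> V.
Hypothesis opDl : forall a b x, op (a + b) x = op a x + op b x.
Hypothesis opDr : forall a x y, op a (x + y) = op a x + op a y.
Hypothesis opF : forall i j a x, a \in F i -> x \in G j -> op a x \in G (i + j).

Definition gr_op_comp (a : gr F) (x : gr G) (n : nat) : gr_piece G n :=
  \sum_(i < n.+1) gr_cls G n (op (gr_rep (a i)) (gr_rep (x (n - i)%N))).

Lemma gr_rep_succ (W : zmodType) (E : nat -> zmodClosed W) i
  (q : gr_piece E i) : q = 0 -> gr_rep q \in E i.+1.
Proof.
move=> ->; rewrite -[gr_rep _]subr0; apply: (@sqclsP _ (E i)).
- exact: sqrepP.
- exact: rpred0.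
- by rewrite sqrepK sqcls0 ?rpred0.
Qed.

Lemma gr_op_in n i a x : (i <= n)%N ->
  a \in F i -> x \in G (n - i)%N -> op a x \in G n.
Proof. by move=> le_in aF xG; rewrite -(subnKC le_in) opF. Qed.

Lemma gr_op_inl n i a x : (i <= n)%N ->
  a \in F i.+1 -> x \in G (n - i)%N -> op a x \in G n.+1.
Proof. by move=> le_in aF xG; rewrite -(subnKC le_in) -addSn opF. Qed.

Lemma gr_op_inr n i a x : (i <= n)%N ->
  a \in F i -> x \in G (n - i).+1 -> op a x \in G n.+1.
Proof. by move=> le_in aF xG; rewrite -(subnKC le_in) -addnS opF. Qed.

Lemma gr_op_fin a x : exists n, forall i, (n <= i)%N -> gr_op_comp a x i = 0.
Proof.
case: (gr_finite a) (gr_finite x) => [m am] [p xp]; exists (m + p)%N => n le_n.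
rewrite /gr_op_comp big1 // => -[i /= /ltnSE le_in] _; rewrite /gr_cls sqcls0 //.
have [le_mi|lt_im] := leqP m i.
  by apply: (gr_op_inl le_in); rewrite ?sqrepP // gr_rep_succ ?am.
apply: (gr_op_inr le_in); rewrite ?sqrepP // gr_rep_succ // xp //.
by rewrite leq_subRL // (leq_trans _ le_n) // leq_add2r ltnW.
Qed.
Definition gr_op a x : gr G := Gr (gr_op_fin a x).

Lemma gr_repD (W : zmodType) (E : nat -> zmodClosed W) i (p q : gr_piece E i) :
  exists2 e, (e \in E i) && (e \in E i.+1)
           & gr_rep (p + q) = gr_rep p + gr_rep q + e.
Proof.
exists (gr_rep (p + q) - (gr_rep p + gr_rep q)); last by rewrite [RHS]addrC subrK.
have dE : gr_rep p + gr_rep q \in E i by rewrite rpredD ?sqrepP.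
rewrite rpredB ?sqrepP //=; apply: (@sqclsP _ (E i)) => //.
- exact: sqrepP.
- by rewrite sqclsD ?sqrepP // !sqrepK.
Qed.

Lemma gr_opDl a b x : gr_op (a + b) x = gr_op a x + gr_op b x.
Proof.
apply: grP => n; rewrite /= /gr_op_comp -big_split /=.
apply: eq_bigr => -[i /= /ltnSE le_in] _; rewrite /gr_cls.
have [e /andP[e0 e1] ->] := gr_repD (a i) (b i).
have xG : gr_rep (x (n - i)%N) \in G (n - i)%N by apply: sqrepP.
have in_n := gr_op_in le_in _ xG.
rewrite !opDl sqclsD ?sqclsD ?rpredD ?in_n ?sqrepP //.
by rewrite [X in _ + X]sqcls0 ?addr0 // (gr_op_inl le_in).
Qed.

Lemma gr_opDr a x y : gr_op a (x + y) = gr_op a x + gr_op a y.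
Proof.
apply: grP => n; rewrite /= /gr_op_comp -big_split /=.
apply: eq_bigr => -[i /= /ltnSE le_in] _; rewrite /gr_cls.
have [e /andP[e0 e1] ->] := gr_repD (x (n - i)%N) (y (n - i)%N).
have aF : gr_rep (a i) \in F i by apply: sqrepP.
have in_n := gr_op_in le_in aF.
rewrite !opDr sqclsD ?sqclsD ?rpredD ?in_n ?sqrepP //.
by rewrite [X in _ + X]sqcls0 ?addr0 // (gr_op_inr le_in).
Qed.

Lemma gr_op1l (u : U) : u \in F 0 -> (forall x, op u x = x) ->
  forall x, gr_op (gr_hom F 0 u) x = x.
Proof.
move=> u0 opu x; apply: grP => n; rewrite /= /gr_op_comp big_ord_recl /=.
rewrite [X in _ + X]big1 => [|i _]; last first.
  rewrite /gr_cls sqcls0 //.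
  apply: (@gr_op_inl _ (bump 0 i)); rewrite ?sqrepP ?gr_rep_succ //.
rewrite addr0 subn0 /gr_cls.
set v := gr_rep (gr_hom_comp _ _ _ _); set w := gr_rep _.
have vF : v \in F 0 by apply: sqrepP.
have wG : w \in G n by apply: sqrepP.
have vu : v - u \in F 1.
  by apply: (@sqclsP _ (F 0)); rewrite // /v /gr_rep sqrepK.
rewrite -[v](subrK u) addrC opDl opu sqclsD //.
  by rewrite [X in _ + X]sqcls0 ?addr0 ?sqrepK // -[n.+1]add1n opF.
by rewrite -[n in G n]add0n opF // rpredB.
Qed.

Lemma gr_op1r (v : V) : v \in G 0 -> forall phi : U -> V,
  (forall a, op a v = phi a) -> (forall i a, a \in F i -> phi a \in G i) ->
  forall a n, gr_op a (gr_hom G 0 v) n = gr_cls G n (phi (gr_rep (a n))).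
Proof.
move=> v0 phi opv phiF a n; rewrite /= /gr_op_comp big_ord_recr /=.
rewrite big1 => [|[i /= lt_in] _]; last first.
  rewrite /gr_cls sqcls0 //.
  apply: (@gr_op_inr _ i); rewrite ?sqrepP ?(ltnW lt_in) // gr_rep_succ //.
  by rewrite /gr_hom_comp subn_eq0 leqNgt lt_in.
rewrite add0r /gr_cls; set b := gr_rep (a n).
have bF : b \in F n by apply: sqrepP.
move: (subnn n); move: (n - n)%N => k k0; rewrite {k}k0.
set w := gr_rep _.
have wG : w \in G 0 by apply: sqrepP.
have wv : w - v \in G 1.
  by apply: (@sqclsP _ (G 0)); rewrite // /w /gr_rep sqrepK.
rewrite -[w](subrK v) addrC opDr opv sqclsD ?phiF //.
  by rewrite [X in _ + X]sqcls0 ?addr0 // -[n.+1]addn1 opF.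
by rewrite -[n in G n]addn0 opF // rpredB.
Qed.

End GradedOp.

Definition gr_ring (R : naRingType) (F : ringFiltration R) : Type := gr F.

Section GradedRing.
Variables (R : naRingType) (F : ringFiltration R).
Local Notation A := (gr_ring F).

HB.instance Definition _ := GRing.Zmodule.on A.

Definition gr_one : A := gr_hom F 0 na_one.
Definition gr_mul : A -> A -> A := @gr_op _ _ F F (@na_mul R) (@rfil_mul R F).

Lemma gr_mulDl a b c : gr_mul (a + b) c = gr_mul a c + gr_mul b c.
Proof. apply: gr_opDl; exact: na_mulDl. Qed.

Lemma gr_mulDr a b c : gr_mul a (b + c) = gr_mul a b + gr_mul a c.
Proof. apply: gr_opDr; exact: na_mulDr. Qed.

Lemma gr_mul1l a : gr_mul gr_one a = a.
Proof. by apply: gr_op1l; [exact: na_mulDl | exact: rfil0 | exact: na_mul1l]. Qed.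

Lemma gr_mul1r a : gr_mul a gr_one = a.
Proof.
apply: grP => i.
rewrite (gr_op1r (@na_mulDr R) (@rfil_mul R F) (rfil0 F _) (phi := id)) //.
  exact: sqrepK.
exact: na_mul1r.
Qed.

HB.instance Definition _ := Zmodule_isNaRing.Build A
  gr_mulDl gr_mulDr gr_mul1l gr_mul1r.

(* The structure map of the R / F^1(R)-algebra gr(R). *)
Definition gr_scalar (c : quot_ring F 1) : A :=
  gr_hom F 0 (repr (c : {ideal_quot F 1})).

Definition gr_subalgebra (S : set A) :=
  [/\ S na_one, forall a b, S a -> S b -> S (a - b),
      forall a b, S a -> S b -> S (a ** b)
    & forall c a, S a -> S (gr_scalar c ** a)].

Definition gr_generated (X : set A) := smallest gr_subalgebra X = setT.

End GradedRing.

Definition gr_space (R : naRingType) (F : ringFiltration R) (M : spaceType R)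
  (G : spaceFiltration F M) : Type := gr G.

Section GradedSpace.
Variables (R : naRingType) (F : ringFiltration R).
Variables (M : spaceType R) (G : spaceFiltration F M).
Local Notation N := (gr_space G).

HB.instance Definition _ := GRing.Zmodule.on N.

Definition gr_act : gr_ring F -> N -> N :=
  @gr_op _ _ F G (@na_act R M) (@sfil_act R F M G).

Lemma gr_actDl a b x : gr_act (a + b) x = gr_act a x + gr_act b x.
Proof. apply: gr_opDl; exact: na_actDl. Qed.

Lemma gr_actDr a x y : gr_act a (x + y) = gr_act a x + gr_act a y.
Proof. apply: gr_opDr; exact: na_actDr. Qed.

Lemma gr_act1 x : gr_act na_one x = x.
Proof. by apply: gr_op1l; [exact: na_actDl | exact: rfil0 | exact: na_act1]. Qed.

HB.instance Definition _ := Zmodule_isSpace.Build (gr_ring F) N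
  gr_actDl gr_actDr gr_act1.

End GradedSpace.

Definition complete_local_filtered (R : naRingType) (F : ringFiltration R) :=
  [/\ complete F,
      na_field (quot_ring F 1),
      na_commutative (gr_ring F),
      exists s : seq (gr_ring F), gr_generated [set` s]
    & gr_generated (@gr_deg R F 1 : set (gr_ring F))].

Definition fg_module (A : naRingType) (N : spaceType A) :=
  (forall (a b : A) (x : N), (a ** b) **: x = a **: (b **: x)) /\
  exists s : seq N, forall x : N, exists c : 'I_(size s) -> A,
    x = \sum_i c i **: s`_i.

Definition permissible (R : naRingType) (F : ringFiltration R)
    (M : spaceType R) (G : spaceFiltration F M) :=
  (forall x, (forall i, x \in G i) -> x = 0) /\ fg_module (gr_space G).

(* Prime ideals and Krull dimension are meant for commutative A only. *)
Definition prime_ideal (A : naRingType) (P : set A) :=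
  [/\ P 0 /\ (forall a b, P a -> P b -> P (a - b)),
      forall a b, P b -> P (a ** b) /\ P (b ** a),
      ~ P na_one
    & forall a b, P (a ** b) -> P a \/ P b].

Definition annihilator (A : naRingType) (N : spaceType A) : set A :=
  [set a | forall x : N, a **: x = 0].

Definition prime_chain (A : naRingType) (I : set A) (n : nat) :=
  exists P : nat -> set A,
    (forall i, (i <= n)%N -> prime_ideal (P i) /\ I `<=` P i) /\
    (forall i, (i < n)%N -> P i `<` P i.+1).

(* dim (A / Ann N): the supremum of the lengths n of the chains
   P_0 < ... < P_n of primes containing Ann N.  It is +oo when the lengths
   are unbounded, and -oo for the zero module. *)
Definition krull_dim (A : naRingType) (N : spaceType A) : \bar int :=
  supremum (-oo)%E [set (n%:Z)%:E%E | n in prime_chain (annihilator N)].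

(* Main.v *)
(* If [gr_G M] is generated over [gr R] by the classes of [x_1, ..., x_n], in
   degrees [< c], then successive approximation and completeness of [R] give
   [G^i M <= sum_t F^(i - c) x_t] ([i - c] truncated at 0), whence
   [G^i M <= H^(i - c) M] for any other filtration [H].  So [G] and [H] are
   within a bounded shift of each other.  If the symbol of [r] in [F^d R] kills
   [gr_H M], then [r H^i <= H^(i + d + 1)]: each application of [r] gains one
   step, so a high enough power of the symbol kills [gr_G M].  Hence the two
   annihilators are contained in the same primes. *)
Require Import Defs.
From HB Require Import structures.
From mathcomp Require Import all_boot all_order all_algebra.
From mathcomp Require Import boolp classical_sets constructive_ereal.
From mathcomp Require Import zify.

Set Implicit Arguments.
Unset Strict Implicit.
Unset Printing Implicit Defensive.

Import Order.TTheory GRing.Theory Num.Theory.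

Local Open Scope ring_scope.
Local Open Scope quotient_scope.
Local Open Scope classical_set_scope.

(** * Additivity of the action *)

Lemma morphD_zmod_morphism (U V : zmodType) (f : U -> V) :
  (forall x y, f (x + y) = f x + f y) -> zmod_morphism f.
Proof.
by move=> fD x y; apply: (addIr (f y)); rewrite -fD !subrK.
Qed.

HB.instance Definition _ (R : naRingType) (M : spaceType R) (a : R) :=
  GRing.isZmodMorphism.Build M M (na_act a) (morphD_zmod_morphism (na_actDr a)).

Lemma na_actB (R : naRingType) (M : spaceType R) (a b : R) (x : M) :
  (a - b) **: x = a **: x - b **: x.
Proof. exact: (morphD_zmod_morphism (fun c d : R => na_actDl c d x)). Qed.

Lemma na_act0 (R : naRingType) (M : spaceType R) (x : M) : (0 : R) **: x = 0.
Proof. by rewrite -(subrr 0) na_actB subrr. Qed.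

(** * Homogeneous classes in a graded group *)

Section GradedTheory.
Variables (V : zmodType) (F : nat -> zmodClosed V).

Lemma gr_clsK i (q : gr_piece F i) : gr_cls F i (gr_rep q) = q.
Proof. exact: sqrepK. Qed.

Lemma gr_rep_cls i v : v \in F i -> gr_rep (gr_cls F i v) - v \in F i.+1.
Proof.
by move=> vF; apply: (@sqclsP _ (F i)); rewrite ?sqrepP // /gr_rep sqrepK.
Qed.

Lemma gr_cls_eq0 i v : v \in F i -> gr_cls F i v = 0 -> v \in F i.+1.
Proof.
move=> vF v0; rewrite -[v]subr0; apply: (@sqclsP _ (F i)) => //.
  exact: rpred0.
by rewrite (sqcls0 _ (rpred0 _)).
Qed.

Lemma gr_cls_sum (I : finType) i (v : I -> V) : (forall t, v t \in F i) ->
  gr_cls F i (\sum_t v t) = \sum_t gr_cls F i (v t).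
Proof.
move=> vF; elim: index_enum => [|t s IHs].
  by rewrite !big_nil [LHS]sqcls0 ?rpred0.
by rewrite !big_cons [LHS]sqclsD ?rpred_sum //; congr (_ + _).
Qed.

Lemma gr_compD (x y : gr F) i : (x + y) i = x i + y i.
Proof. by []. Qed.

Lemma gr_comp_sum (I : Type) (s : seq I) (x : I -> gr F) i :
  (\sum_(t <- s) x t) i = \sum_(t <- s) x t i.
Proof. by elim: s => [|t s IHs]; rewrite ?big_nil // !big_cons gr_compD IHs. Qed.

Lemma gr_homE i v : gr_hom F i v i = gr_cls F i v.
Proof. by rewrite /= /gr_hom_comp eqxx. Qed.

Lemma gr_hom_neq i v j : j != i -> gr_hom F i v j = 0.
Proof. by rewrite /= /gr_hom_comp => /negbTE->. Qed.

Lemma gr_hom0 i v : v \in F i.+1 -> gr_hom F i v = 0.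
Proof.
move=> vF; apply: grP => j; have [->|ji] := eqVneq j i; last exact: gr_hom_neq.
by rewrite gr_homE [LHS]sqcls0.
Qed.

Lemma gr_sum_hom (x : gr F) :
  exists n, x = \sum_(i < n) gr_hom F i (gr_rep (x i)).
Proof.
have [n xn] := gr_finite x; exists n; apply: grP => i.
rewrite gr_comp_sum.
have [lt_in|le_ni] := ltnP i n.
  rewrite (bigD1 (Ordinal lt_in)) // [X in _ = X + _](gr_homE i) gr_clsK.
  rewrite big1 ?addr0 // => j ji; apply: gr_hom_neq.
  by apply: contraNneq ji => ij; apply/eqP/val_inj.
rewrite xn // big1 // => j _; apply: gr_hom_neq.
by rewrite gtn_eqF // (leq_trans (ltn_ord j)).
Qed.

End GradedTheory.

(** * Products with homogeneous classes *)

Section GradedOpTheory.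
Variables (U V : zmodType) (F : nat -> zmodClosed U) (G : nat -> zmodClosed V).
Variable op : U -> V -> V.
Hypothesis opDl : forall a b x, op (a + b) x = op a x + op b x.
Hypothesis opDr : forall a x y, op a (x + y) = op a x + op a y.
Hypothesis opF : forall i j a x, a \in F i -> x \in G j -> op a x \in G (i + j).

(** Only the component of degree [n - j] of [a] can meet the symbol of [x]: in every other term the
    representative of a zero component already lies one step deeper. Replacing the representative of
    the symbol by [x] itself changes the product by an element of [G n.+1]. *)
Lemma gr_op_homr n j a x : x \in G j ->
  gr_op opF a (gr_hom G j x) n =
    if (j <= n)%N then gr_cls G n (op (gr_rep (a (n - j)%N)) x) else 0.
Proof.
move=> xG; rewrite [LHS]/= /gr_op_comp.
have zero k : (k <= n)%N -> (n - k != j)%N ->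
    gr_cls G n (op (gr_rep (a k)) (gr_rep (gr_hom G j x (n - k)%N))) = 0.
  move=> le_kn kj; rewrite [LHS]sqcls0 //.
  apply: (gr_op_inr opF le_kn); rewrite ?sqrepP ?gr_rep_succ //.
  exact: gr_hom_neq.
case: ifP => [le_jn|jn]; last first.
  rewrite big1 // => -[k /= /ltnSE le_kn] _; apply: zero => //.
  by apply: contraFneq jn => <-; apply: leq_subr.
have lt_n : (n - j < n.+1)%N by rewrite ltnS leq_subr.
rewrite (bigD1 (Ordinal lt_n)) //= big1 ?addr0 => [|[k lt_kn] kj]; last first.
  apply: zero; first exact: lt_kn.
  apply: contraNneq kj => nkj.
  by rewrite -val_eqE /= -nkj subKn.
rewrite subKn // [gr_hom_comp _ _ _ _]gr_homE.
set b := gr_rep (a _); have bF : b \in F (n - j)%N by apply: sqrepP.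
set y := gr_rep _; have yG : y \in G j by apply: sqrepP.
have -> : op b y = op b x + op b (y - x) by rewrite -opDr [x + _]addrC subrK.
have dG : op b (y - x) \in G n.+1.
  by apply: (gr_op_inr opF (leq_subr j n)); rewrite ?subKn // gr_rep_cls.
rewrite [LHS]sqclsD; first by rewrite [X in _ + X]sqcls0 ?addr0.
- by rewrite -(subnK le_jn) opF.
- by rewrite -(subnK le_jn) opF // rpredB.
Qed.

Lemma gr_op_hom i j a x : a \in F i -> x \in G j ->
  gr_op opF (gr_hom F i a) (gr_hom G j x) = gr_hom G (i + j) (op a x).
Proof.
move=> aF xG; apply: grP => n; rewrite gr_op_homr //.
have [->|nij] := eqVneq n (i + j)%N.
  rewrite leq_addl addnK !gr_homE.
  set b := gr_rep _; have bF : b \in F i by apply: sqrepP.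
  have -> : op b x = op a x + op (b - a) x by rewrite -opDl [a + _]addrC subrK.
  rewrite [LHS]sqclsD ?opF ?rpredB //.
  by rewrite [X in _ + X]sqcls0 ?addr0 // -addSn opF // gr_rep_cls.
rewrite [RHS]gr_hom_neq //; case: ifP => // le_jn; rewrite [LHS]sqcls0 //.
rewrite -[n in G n.+1](subnK le_jn) -addSn opF // gr_rep_succ // gr_hom_neq //.
by apply: contraNneq nij => <-; rewrite subnK.
Qed.

End GradedOpTheory.

(** * Generators by successive approximation *)

Section Approximation.
Variables (R : naRingType) (F : ringFiltration R).
Variables (M : spaceType R) (G : spaceFiltration F M).

Lemma rfil_le i j a : (i <= j)%N -> a \in F j -> a \in F i.
Proof. by move/subnK <-; elim: (j - i)%N => // k IHk /rfil_decr/IHk. Qed.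

Lemma sfil_le i j x : (i <= j)%N -> x \in G j -> x \in G i.
Proof. by move/subnK <-; elim: (j - i)%N => // k IHk /sfil_decr/IHk. Qed.

(** For [k >= i + c] the term [u k] lies in [F i], so the partial sum is constant modulo [F i] from
    [i + c] terms on; completeness supplies the limit of these residues. *)
Lemma complete_series (c : nat) (u : nat -> R) : complete F ->
  (forall k, u k \in F (k - c)%N) ->
  exists x, forall i, x - \sum_(k < i + c) u k \in F i.
Proof.
move=> cF uF.
have [i|x [xP _]] := cF (fun i => \pi_{ideal_quot F i} (\sum_(k < i + c) u k)).
  apply/quot_eqP; set r := repr _.
  have rF : r - \sum_(k < i.+1 + c) u k \in F i.
    by apply: rfil_decr; apply/quot_eqP; rewrite reprK.
  rewrite -[r](subrK (\sum_(k < i.+1 + c) u k)) -addrA rpredD //.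
  by rewrite addSn big_ord_recr /= addrAC subrr add0r -[i in F i](addnK c).
by exists x => i; apply/quot_eqP.
Qed.

(** The homogeneous components of the module generators generate too; [m] lifts them to [M], indexed
    by generator and degree, and [c] bounds the degrees. *)
Lemma fg_approx : fg_module (gr_space G) ->
  exists c (T : finType) (m : T -> M), forall i y, y \in G i ->
    exists a : T -> R, (forall t, a t \in F (i - c)%N) /\
      y - \sum_t a t **: m t \in G i.+1.
Proof.
move=> [_ [s sP]].
have [c cP] : exists c, forall (j : 'I_(size s)) k, (c <= k)%N -> s`_j k = 0.
  have /choice[e eP] := fun j : 'I_(size s) => gr_finite s`_j.
  exists (\max_j e j)%N => j k le_k; apply: eP; apply: leq_trans le_k.
  exact: leq_bigmax.
pose m (t : 'I_(size s) * 'I_c) := gr_rep (s`_t.1 t.2).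
exists c, ('I_(size s) * 'I_c)%type, m => i y yG.
have [b bP] := sP (gr_hom G i y).
(* A component of degree [e] needs a coefficient of degree [i - e]. For [e > i] the truncated
   subtraction would give a spurious degree 0, hence the default 0. *)
pose a (t : 'I_(size s) * 'I_c) :=
  if (t.2 <= i)%N then gr_rep ((b t.1 : gr F) (i - t.2)%N) else 0.
exists a; split=> [t|].
  rewrite /a; case: ifP => _; last exact: rpred0.
  apply: (@rfil_le _ (i - t.2)); last exact: sqrepP.
  by rewrite leq_sub2l // ltnW.
(* Defined for all naturals [e], because the lifts range over [e < c] and a product in degree [i]
   over [e <= i]; both sums are extended by zeros to length [c + i.+1]. *)
pose g j e : gr_piece G i := if (e <= i)%N then
  gr_cls G i (gr_rep ((b j : gr F) (i - e)%N) **: gr_rep (s`_j e)) else 0.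
have g0c j e : (c <= e)%N -> g j e = 0.
  rewrite /g => le_ce; case: ifP => // le_ei; rewrite [LHS]sqcls0 //.
  rewrite -[i in G i.+1](subnK le_ei) -addnS sfil_act ?sqrepP //.
  by rewrite gr_rep_succ // cP.
have g0i j e : (i < e)%N -> g j e = 0 by rewrite /g ltnNge => /negbTE->.
have widen_g j p : (forall e, (p <= e)%N -> g j e = 0) -> (p <= c + i.+1)%N ->
    \sum_(e < p) g j e = \sum_(e < c + i.+1) g j e.
  move=> gp le_p; rewrite (big_ord_widen _ (g j) le_p) big_mkcond /=.
  by apply: eq_bigr => e _; case: ltnP => // /gp.
have sum_g j : \sum_(e < c) g j e = (b j **: s`_j : gr G) i.
  rewrite (widen_g j) ?leq_addr //; last exact: g0c.
  rewrite -(widen_g j i.+1) ?leq_addl //; last exact: g0i.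
  (* [gr_op_comp] sums over the degree of the ring factor, [g] over that of the module factor. *)
  rewrite [RHS]/= /gr_op_comp (reindex_inj rev_ord_inj); apply: eq_bigr => k _.
  by rewrite /g /= subSS leq_subr subKn // -ltnS.
have amG t : a t **: m t \in G i.
  rewrite /a; case: ifP => [le_ti|_]; last by rewrite na_act0 rpred0.
  by rewrite -[i in G i](subnK le_ti) sfil_act // sqrepP.
apply: gr_cls_eq0; first by rewrite rpredB // rpred_sum.
set z := \sum_t _; have zG : z \in G i by rewrite rpred_sum.
suff yz : gr_cls G i y = gr_cls G i z.
  apply: (addIr (gr_cls G i z)); rewrite add0r -[RHS]yz.
  by rewrite -[LHS]sqclsD ?rpredB // subrK.
rewrite -gr_homE bP gr_comp_sum gr_cls_sum //.
rewrite -(pair_bigA _ (fun j e => gr_cls G i (a (j, e) **: m (j, e)))) /=.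
apply: eq_bigr => j _; apply: etrans (esym (sum_g j)) _.
apply: eq_bigr => e _.
by rewrite /g /a /=; case: ifP => // _; rewrite na_act0 [RHS]sqcls0 ?rpred0.
Qed.

Lemma generators_of_fg : complete F -> permissible G ->
  exists c (T : finType) (m : T -> M), forall i y, y \in G i ->
    exists2 a : T -> R, (forall t, a t \in F (i - c)%N) & y = \sum_t a t **: m t.
Proof.
move=> cF [sepG /fg_approx[c [T [m mP]]]]; exists c, T, m => i y yG.
(* One function for all pairs of a degree and a remainder makes the recursion [z] possible; outside
   [G] its value is arbitrary. *)
have /choice[f fP] : forall p : nat * M, exists a : T -> R, p.2 \in G p.1 ->
    (forall t, a t \in F (p.1 - c)%N) /\ p.2 - \sum_t a t **: m t \in G p.1.+1.
  move=> [k z] /=; case: (boolP (z \in G k)) => [/mP[a aP]|_]; first by exists a.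
  by exists (fun=> 0).
pose z := fix z k := if k is k'.+1
  then z k' - \sum_t f ((i + k')%N, z k') t **: m t else y.
have zG k : z k \in G (i + k)%N.
  elim: k => [|k IHk]; first by rewrite addn0.
  by rewrite addnS; case: (fP ((i + k)%N, z k)) => // _.
pose u t k := f ((i + k)%N, z k) t.
have uF t k : u t k \in F (i + k - c)%N.
  by have [/(_ t)] := fP ((i + k)%N, z k) (zG k).
have /choice[a aP] t : exists x, forall k, x - \sum_(l < k + c) u t l \in F k.
  apply: complete_series => // k; apply: rfil_le (uF t k).
  by rewrite leq_sub2r ?leq_addl.
have zE k : z k = y - \sum_t (\sum_(l < k) u t l) **: m t.
  elim: k => [|k IHk].
    rewrite big1 ?subr0 // => t _; rewrite big_ord0.
    exact: na_act0.
  rewrite /= IHk -addrA -opprD -big_split /=; congr (_ - _).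
  by apply: eq_bigr => t _; rewrite big_ord_recr na_actDl -IHk.
exists a => [t|].
  rewrite -[a t](subrK (\sum_(l < i + c) u t l)) rpredD //.
    by apply: rfil_le (aP t i); apply: leq_subr.
  by apply: rpred_sum => l _; apply: rfil_le (uF t l); rewrite leq_sub2r ?leq_addr.
(* Up to tails of the coefficients, which lie in [F k], the difference is the remainder after
   [k + c] rounds, and that one is in [G (i + (k + c))]. *)
apply/eqP; rewrite -subr_eq0; apply/eqP/sepG => k.
have -> : y - \sum_t a t **: m t
    = z (k + c)%N - \sum_t (a t - \sum_(l < k + c) u t l) **: m t.
  rewrite zE -addrA -opprD -big_split /=; congr (_ - _); apply: eq_bigr => t _.
  by rewrite na_actB addrC subrK.
rewrite rpredB //.
  by apply: sfil_le (zG _); rewrite addnCA leq_addr.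
apply: rpred_sum => t _; rewrite -[k in G k]addn0.
by rewrite sfil_act ?sfil0.
Qed.

End Approximation.

(** The generators lie in [H 0], which is all of [M], so coefficients in [F (i - c)] carry them into
    [H (i - c)]. *)
Lemma filtration_shift (R : naRingType) (F : ringFiltration R) (M : spaceType R)
    (G H : spaceFiltration F M) : complete F -> permissible G ->
  exists c, forall i y, y \in G i -> y \in H (i - c)%N.
Proof.
move=> cF /(generators_of_fg cF)[c [T [m mP]]]; exists c => i y /mP[a aF ->].
apply: rpred_sum => t _; rewrite -[(i - c)%N]addn0.
by rewrite sfil_act ?sfil0.
Qed.

(** * Annihilators and the primes containing them *)

Section Annihilator.
Variables (R : naRingType) (F : ringFiltration R) (M : spaceType R).

Lemma gr_act_hom (G : spaceFiltration F M) i j a x : a \in F i -> x \in G j ->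
  (gr_hom F i a : gr_ring F) **: (gr_hom G j x : gr_space G)
    = gr_hom G (i + j) (a **: x).
Proof. exact: gr_op_hom (@na_actDl R M) (@na_actDr R M) _ _ _ _ _. Qed.

(** Multiplied by the symbol of [x], [a] contributes only its component [d] in degree [d + i]; the
    vanishing of that class pushes the product one step deeper. *)
Lemma annihilator_comp (G : spaceFiltration F M) (a : gr_ring F) d i x :
  annihilator (gr_space G) a -> x \in G i ->
  gr_rep ((a : gr F) d) **: x \in G (d + i).+1.
Proof.
move=> a0 xG; have aF : gr_rep ((a : gr F) d) \in F d by apply: sqrepP.
apply: gr_cls_eq0; first exact: sfil_act.
have := congr1 (fun y : gr G => y (d + i)%N) (a0 (gr_hom G i x)).
by rewrite [LHS](gr_op_homr (@na_actDr R M)) // leq_addl addnK.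
Qed.

(** Iterated actions stand in for powers of [r], since the action on [M] need not be associative. *)
Lemma iter_act_hom (G : spaceFiltration F M) d r n i x : r \in F d -> x \in G i ->
  iter n (na_act (gr_hom F d r : gr_ring F)) (gr_hom G i x : gr_space G)
    = gr_hom G (n * d + i) (iter n (na_act r) x).
Proof.
move=> rF xG; elim: n => [//|n IHn].
have inG : iter n (na_act r) x \in G (n * d + i)%N.
  by elim: n {IHn} => [//|n IHn]; rewrite iterS mulSn -addnA sfil_act.
by rewrite !iterS IHn gr_act_hom // mulSn addnA.
Qed.

Lemma prime_annihilator (G H : spaceFiltration F M) (P : set (gr_ring F)) :
  complete F -> permissible G -> permissible H -> prime_ideal P ->
  annihilator (gr_space G) `<=` P -> annihilator (gr_space H) `<=` P.
Proof.
move=> cF pG pH [[P0 PB] PM P1 Pprime] annP a a0.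
have [c cP] := filtration_shift H cF pG.
have [e eP] := filtration_shift G cF pH.
have PD x y : P x -> P y -> P (x + y).
  by move=> Px Py; rewrite -[y]opprK -[- y]sub0r; do 2!apply: (PB) => //.
(* It is enough to put each homogeneous component of [a] in [P]. *)
have [n ->] := gr_sum_hom a.
elim/big_ind: _ => // -[d /= _] _.
set r := gr_rep _.
have rF : r \in F d by apply: sqrepP.
pose b : gr_ring F := gr_hom F d r.
have rH i x : x \in H i -> r **: x \in H (d + i).+1 := annihilator_comp d a0.
have rHn k i x : x \in H i -> iter k (na_act r) x \in H (k * d.+1 + i)%N.
  by move=> xH; elim: k => // k /rH; rewrite iterS mulSn !addSn -addnA.
have bP k : P (iter k (na_mul b) na_one) -> P b.
  by elim: k => [/P1 //|k IHk]; rewrite iterS => /Pprime[|/IHk].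
(* Passing from [G] to [H] loses [c] steps and coming back loses [e], while each application of [r]
   gains one beyond its degree [d]; [c + e + 1] applications leave a net gain of one, which kills
   the symbol. *)
apply: (bP (c + e).+1); apply: annP => x.
(* The graded action is associative by permissibility, so nested products act by iteration. *)
have actM k (w : gr_space G) : iter k (na_mul b) na_one **: w = iter k (na_act b) w.
  case: pG => _ [actA _].
  by elim: k => [|k IHk]; rewrite ?na_act1 // !iterS actA IHk.
rewrite actM.
have [m ->] := gr_sum_hom x.
have iterD k : {morph iter k (na_act b) : u v / u + v :> gr_space G}.
  by elim: k => // k IHk u v; rewrite !iterS IHk na_actDr.
have iter0 k : iter k (na_act b) (0 : gr_space G) = 0.
  by elim: k => // k IHk; rewrite iterS IHk raddf0.
rewrite (big_morph _ (iterD _) (iter0 _)) big1 // => i _.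
set w := gr_rep _.
have wG : w \in G i by apply: sqrepP.
rewrite iter_act_hom // gr_hom0 //.
apply: sfil_le (eP _ _ (rHn _ _ _ (cP _ _ wG))).
nia.
Qed.

End Annihilator.

(** * Equality of the Krull dimensions *)

Theorem proposition5p3 (R : naRingType) (F : ringFiltration R)
    (hR : complete_local_filtered F) (M : spaceType R)
    (G H : spaceFiltration F M) (hG : permissible G) (hH : permissible H) :
  krull_dim (gr_space G : spaceType (gr_ring F)) =
  krull_dim (gr_space H : spaceType (gr_ring F)).
Proof.
case: hR => cF _ _ _ _.
(* The same primes form the new chain: only the containment of the annihilator has to be
   transported. *)
have chain (G1 H1 : spaceFiltration F M) n : permissible G1 -> permissible H1 ->
    prime_chain (annihilator (gr_space G1)) n ->
    prime_chain (annihilator (gr_space H1)) n.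
  move=> pG pH [P [PP Plt]]; exists P; split=> // i /PP[Pi annP]; split=> //.
  exact: prime_annihilator annP.
rewrite /krull_dim; congr supremum; apply/seteqP; split=> _ [n nP <-];
  by exists n => //; apply: chain nP.
Qed.
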